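(* Let $\mathcal{C}$ be a class of finite graphs each of which is a complete $d$-partite graph $K_{m_0,\dots,m_{d-1}}$ for some $d\in\mathbb{N}$ (with $d$ allowed to vary between graphs). For such a graph let $M:=\max_{i<d}m_i$ and $N:=\sum_{i<d}m_i$. The following are equivalent: (1) $\mathcal{C}$ is $\mathrm{MSO}_2$-orderable; (2) there is a constant $s\in\mathbb{N}$ such that $\mathcal{C}$ has property $\mathsf{SEP}(f)$ for $f(k)=2^{s(k+1)}$; (3) there is a constant $s\in\mathbb{N}$ such that every $K_{m_0,\dots,m_{d-1}}\in\mathcal{C}$ satisfies $M\le 2^{s(N-M+1)}$.
   Context: For $G=\langle V,E\rangle$, $\lceil G\rceil=\langle V\cup E,\mathrm{inc}\rangle$ (universe $V\cup E$, incidence relation). An MSO-formula $\varphi(x,y;Z_0,\dots,Z_{k-1})$ defines an order on a class $\mathcal{K}$ of structures if for every non-empty $\mathfrak{A}\in\mathcal{K}$ there are $P_0,\dots,P_{k-1}\subseteq A$ with $\{(a,b):\mathfrak{A}\models\varphi(a,b;\bar P)\}$ a linear order on $A$; a graph class is $\mathrm{MSO}_2$-orderable if some MSO-formula defines an order on $\{\lceil G\rceil\}$. $\mathrm{Sep}(G,k)$ is the maximum over vertex sets $S$, $|S|\le k$, of the number of connected components of $G-S$; $\mathcal{C}$ has $\mathsf{SEP}(f)$ if $\mathrm{Sep}(G,k)\le f(k)$ for all $G\in\mathcal{C}$ and all $k$. *)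

(* Defs.v *)
From mathcomp Require Import all_boot.
Set Implicit Arguments. Unset Strict Implicit. Unset Printing Implicit Defensive.

Record graph := Graph {
  gV : finType;
  gadj : rel gV;
  gadj_sym : symmetric gadj;
  gadj_irr : irreflexive gadj }.

Definition is_edge (G : graph) (e : {set gV G}) : bool :=
  [exists x, exists y, gadj x y && (e == [set x; y])].
Definition gE (G : graph) : finType := {e : {set gV G} | is_edge e}.

Definition inc_univ (G : graph) : finType := (gV G + gE G)%type.
Definition inc (G : graph) : rel (inc_univ G) :=
  fun a b => match a, b with
             | inl v, inr e => v \in val e
             | _, _ => false
             end.

(* first-order variables and set variables are named by naturals *)
Inductive mso : Type :=
| MRel : nat -> nat -> mso
| MEq  : nat -> nat -> mso
| MMem : nat -> nat -> mso
| MNeg : mso -> mso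
| MAnd : mso -> mso -> mso
| MEx  : nat -> mso -> mso
| MExS : nat -> mso -> mso.

Definition upd {A : Type} (f : nat -> A) (i : nat) (a : A) : nat -> A :=
  fun n => if n == i then a else f n.

Fixpoint sat (T : finType) (R : rel T) (nu : nat -> T) (mu : nat -> {set T})
    (phi : mso) : Prop :=
  match phi with
  | MRel i j => R (nu i) (nu j)
  | MEq i j => nu i = nu j
  | MMem i X => nu i \in mu X
  | MNeg f => ~ sat R nu mu f
  | MAnd f g => sat R nu mu f /\ sat R nu mu g
  | MEx i f => exists a : T, sat R (upd nu i a) mu f
  | MExS X f => exists A : {set T}, sat R nu (upd mu X A) f
  end.

Fixpoint mso_wf (fb sb : pred nat) (phi : mso) : bool :=
  match phi with
  | MRel i j => fb i && fb j
  | MEq i j => fb i && fb j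
  | MMem i X => fb i && sb X
  | MNeg f => mso_wf fb sb f
  | MAnd f g => mso_wf fb sb f && mso_wf fb sb g
  | MEx i f => mso_wf (fun n => (n == i) || fb n) sb f
  | MExS X f => mso_wf fb (fun n => (n == X) || sb n) f
  end.

Definition linear_order (T : finType) (r : T -> T -> Prop) : Prop :=
  (forall a, r a a) /\
  (forall a b, r a b -> r b a -> a = b) /\
  (forall a b c, r a b -> r b c -> r a c) /\
  (forall a b, r a b \/ r b a).

(* φ(x,y;Z_0..Z_{k-1}) with x = variable 0, y = variable 1, Z_j = set variable j *)
Definition mso_binary_formula (k : nat) (phi : mso) : bool :=
  mso_wf (fun n => n < 2) (fun n => n < k) phi.

Definition pair_asg (T : finType) (a b : T) : nat -> T :=
  fun n => if n == 0 then a else b.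

(* φ defines an order on the structure <T,R> (if non-empty) *)
Definition defines_order_on (k : nat) (phi : mso) (T : finType) (R : rel T) : Prop :=
  forall t0 : T,
  exists P : nat -> {set T},
    linear_order (fun a b : T => sat R (pair_asg a b) P phi).

Definition MSO2_orderable (C : graph -> Prop) : Prop :=
  exists (k : nat) (phi : mso), mso_binary_formula k phi /\
    forall G, C G -> defines_order_on k phi (@inc G).

Definition comps_minus (G : graph) (S : {set gV G}) : nat :=
  n_comp (fun x y => [&& gadj x y, x \notin S & y \notin S]) (~: S).

Definition Sep (G : graph) (k : nat) : nat :=
  \max_(S : {set gV G} | #|S| <= k) comps_minus S.

Definition SEP (C : graph -> Prop) (f : nat -> nat) : Prop :=
  forall G, C G -> forall k, Sep G k <= f k.

(* part : V -> 'I_d exhibits G as K_{m_0,...,m_{d-1}}: two vertices are adjacent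
   iff they lie in different parts; m_i = size of part i. *)
Definition cmp_witness (G : graph) (d : nat) (part : gV G -> 'I_d) : Prop :=
  forall x y, gadj x y = (part x != part y).

Definition part_size (G : graph) (d : nat) (part : gV G -> 'I_d) (i : 'I_d) : nat :=
  #|[set v | part v == i]|.

Definition is_complete_multipartite (G : graph) : Prop :=
  exists d (part : gV G -> 'I_d), cmp_witness part.

(* Main.v *)
Require Import Defs.
From mathcomp Require Import all_boot.
Set Implicit Arguments. Unset Strict Implicit. Unset Printing Implicit Defensive.

(** Removing [S] from a complete multipartite graph leaves at most one component
    unless only vertices of a single part survive, so separation is governed by
    the largest part; this gives (2) <-> (3).

    (1) -> (3): given [k] parameters, label a vertex [v] of the largest part by
    the parameters containing [v] and those containing each edge from [v] to the
    [N - M] outer vertices. Two vertices with the same label are exchanged by an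
    automorphism fixing all parameters, which no definable linear order allows;
    hence [M <= 2 ^ (k * (N - M).+1)].

    (3) -> (1): take a path that cannot be extended at its start [z]. All vertices
    missed by it lie in the part [I] of [z], so the path covers the complement of
    [I]. The path is definably ordered by reachability once its edges are oriented
    by parity of position. By (3) the vertices of [I] can be given distinct labels
    made of [s] bits plus [s] bits for each vertex outside [I]; these are stored as
    sets of vertices and edges and compared lexicographically along the path. An
    edge has at most one endpoint off the path, so the same comparison orders
    edges. *)

Lemma edge_of_adj (G : graph) (x y : gV G) : gadj x y -> exists e : gE G, val e = [set x; y].
Proof.
move=> xy; have xyE : is_edge [set x; y].
  by apply/existsP; exists x; apply/existsP; exists y; rewrite xy eqxx.
by exists (Sub _ xyE).
Qed.

Lemma edge_mem (G : graph) (e : gE G) (x : gV G) : x \in val e ->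
  exists2 y, gadj x y & val e = [set x; y].
Proof.
case/existsP: (valP e) => u /existsP[v /andP[uv /eqP->]].
rewrite !inE => /orP[/eqP->|/eqP->]; first by exists v.
by exists u; rewrite 1?gadj_sym // setUC.
Qed.

(** * Separators of complete multipartite graphs *)

Section Multipartite.
Variables (G : graph) (d : nat) (part : gV G -> 'I_d).
Hypothesis part_witness : cmp_witness part.

Lemma sum_part_size : \sum_(i < d) part_size part i = #|gV G|.
Proof.
rewrite -sum1_card (partition_big part xpredT) //=; apply: eq_bigr => i _.
by rewrite /part_size -sum1_card; apply: eq_bigl => v; rewrite inE.
Qed.

Lemma card_outside_part (i : 'I_d) :
  #|~: [set v | part v == i]| = #|gV G| - part_size part i.
Proof. by rewrite /part_size -(cardsC [set v | part v == i]) addKn. Qed.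

Lemma part_size_le_max (i : 'I_d) :
  part_size part i <= \max_(i < d) part_size part i.
Proof. exact: (leq_bigmax_cond (F := part_size part)). Qed.

Lemma comps_minus_outside_part (i : 'I_d) :
  comps_minus (~: [set v | part v == i]) = part_size part i.
Proof.
rewrite /comps_minus /part_size setCK /n_comp_mem; set e := (X in roots X).
have e0 x y : e x y = false.
  rewrite /e !inE !negbK part_witness.
  by apply/negP => /and3P[nxy /eqP xi /eqP yi]; rewrite xi yi eqxx in nxy.
apply: eq_card => x; rewrite [LHS]unfold_in /= andbC; case: (x \in _) => //=.
have /connectP[[_ rx|y p /=]] := connect_root e x; last by rewrite e0.
by apply/eqP.
Qed.

(** Two survivors in different parts are adjacent, and every further survivor is adjacent to one of
    them, so a single component remains. Otherwise all survivors share a part, and components are at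
    most as many as vertices. *)
Lemma comps_minus_le (S : {set gV G}) :
  comps_minus S <= 1 \/
  exists2 i : 'I_d, ~: [set v | part v == i] \subset S &
    comps_minus S <= part_size part i.
Proof.
case: (boolP [exists a in ~: S, exists b in ~: S, part a != part b]).
  case/exists_inP=> a aS /exists_inP[b bS nab]; left.
  rewrite /comps_minus /n_comp_mem; set e := (X in roots X).
  have symE : symmetric e.
    by move=> x y; rewrite /e gadj_sym; do 2!case: (_ \in _) => //=;
      rewrite ?andbF ?andbT.
  have csym : connect_sym e by apply: sym_connect_sym.
  have ab : connect e a b.
    by apply: connect1; rewrite /e part_witness nab; rewrite !inE in aS bS; rewrite aS bS.
  have conn x : x \in ~: S -> connect e x a.
    move=> xS; rewrite !inE in xS aS bS.
    (* A survivor in the part of [a] reaches [a] through [b]; any other is adjacent to [a]. *)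
    case: (eqVneq (part x) (part a)) => [xa|nxa].
      rewrite csym; apply: connect_trans ab _; apply: connect1.
      by rewrite /e part_witness xa eq_sym nab bS xS.
    by apply: connect1; rewrite /e part_witness nxa aS xS.
  rewrite -(cards1 (root e a)) -[X in X <= _]cardsE; apply/subset_leq_card/subsetP => x.
  rewrite !inE => /andP[/eqP rx xS]; rewrite -rx.
  by apply/eqP/(rootP csym)/conn; rewrite inE.
rewrite negb_exists_in => /forall_inP H.
case: (set_0Vmem (~: S)) => [S0|[a aS]].
  left; rewrite /comps_minus S0 /n_comp_mem eq_card0 // => x.
  by rewrite !inE andbF.
right; exists (part a).
  apply/subsetP=> v; rewrite !inE => nv; apply: contraNT nv => vS.
  move: (H a aS); rewrite negb_exists_in => /forall_inP/(_ v).
  by rewrite inE vS negbK eq_sym => /(_ isT).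
apply: subset_leq_card; apply/subsetP=> v; rewrite !inE => /andP[_ vS].
move: (H a aS); rewrite negb_exists_in => /forall_inP/(_ v).
by rewrite inE vS negbK eq_sym => /(_ isT).
Qed.

(** The complement of a largest part has [N - M] vertices, and removing it leaves [M] isolated
    ones. *)
Lemma Sep_max_part :
  \max_(i < d) part_size part i <=
    Sep G (\sum_(i < d) part_size part i - \max_(i < d) part_size part i).
Proof.
case: (posnP d) => [d0|d_gt0].
  by rewrite [X in X <= _]big_pred0 // => i; have := ltn_ord i; rewrite [X in _ < X]d0.
have [|i ->] := eq_bigmax (part_size part); first by rewrite card_ord.
rewrite sum_part_size -card_outside_part -{1}(comps_minus_outside_part i).
exact: (@leq_bigmax_cond _ (fun S : {set gV G} => #|S| <= _) (@comps_minus G)).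
Qed.

(** A separator that leaves only vertices of one part contains all the others, hence [N - M <= k];
    monotonicity in the exponent then turns the bound at [N - M] into one at [k]. *)
Lemma Sep_le_max_part k :
  Sep G k <= 1 \/
  Sep G k <= \max_(i < d) part_size part i /\
    \sum_(i < d) part_size part i - \max_(i < d) part_size part i <= k.
Proof.
have [|S leSk] := @eq_bigmax_cond _ (fun S : {set gV G} => #|S| <= k) (@comps_minus G).
  by apply/card_gt0P; exists set0; rewrite unfold_in cards0.
rewrite -[LHS]/(Sep G k) => ->.
case: (comps_minus_le S) => [|[i sub le]]; [by left | right; split].
  exact: leq_trans le (part_size_le_max i).
rewrite sum_part_size; apply: leq_trans (leq_sub2l _ (part_size_le_max i)) _.
by rewrite -card_outside_part; apply: leq_trans (subset_leq_card sub) _.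
Qed.

End Multipartite.

Lemma SEP_iff_max_part_bound (C : graph -> Prop)
    (HC : forall G, C G -> is_complete_multipartite G) (s : nat) :
  SEP C (fun k => 2 ^ (s * k.+1)) <->
  (forall G, C G -> forall (d : nat) (part : gV G -> 'I_d), cmp_witness part ->
     let M := \max_(i < d) part_size part i in
     let N := \sum_(i < d) part_size part i in
     M <= 2 ^ (s * (N - M).+1)).
Proof.
split=> [sepC G CG d part wit /= | bound G CG k].
  exact: leq_trans (Sep_max_part wit) (sepC G CG _).
have [d [part wit]] := HC G CG.
case: (Sep_le_max_part wit k) => [le1 | [leM leNM]].
  by apply: leq_trans le1 _; rewrite expn_gt0.
apply: leq_trans leM _; apply: leq_trans (bound G CG d part wit) _.
by rewrite leq_pexp2l // leq_mul2l ltnS leNM orbT.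
Qed.

(** * Automorphisms of incidence structures *)

Section Invariance.
Variables (T : finType) (R : rel T) (h : T -> T).
Hypotheses (hK : involutive h) (hR : forall a b, R (h a) (h b) = R a b).

Lemma involutive_imsetK (A : {set T}) : h @: (h @: A) = A.
Proof. by rewrite -imset_comp (eq_imset _ hK) imset_id. Qed.

(** The assignments correspond only on the free variables, which is the form that passes under
    quantifiers. Being its own inverse, [h] carries witnesses both ways. *)
Lemma sat_automorphism phi (fb sb : pred nat) (nu nu' : nat -> T) (mu mu' : nat -> {set T}) :
  mso_wf fb sb phi ->
  (forall i, fb i -> nu' i = h (nu i)) ->
  (forall X, sb X -> mu' X = h @: mu X) ->
  sat R nu mu phi <-> sat R nu' mu' phi.
Proof.
elim: phi fb sb nu nu' mu mu' =>
  [i j|i j|i X|f IHf|f IHf g IHg|i f IHf|X f IHf] fb sb nu nu' mu mu' /=.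
- by case/andP=> fi fj nuE _; rewrite !nuE // hR.
- by case/andP=> fi fj nuE _; rewrite !nuE //; split=> [->|/(inv_inj hK)].
- case/andP=> fi sX nuE muE; rewrite nuE // muE // mem_imset //; exact: inv_inj.
- by move=> wf nuE muE; have := IHf _ _ _ _ _ _ wf nuE muE; tauto.
- case/andP=> wff wfg nuE muE.
  have := IHf _ _ _ _ _ _ wff nuE muE; have := IHg _ _ _ _ _ _ wfg nuE muE.
  tauto.
- move=> wf nuE muE; split=> [[a sa]|[a sa]]; exists (h a).
    apply: (proj1 (IHf _ _ (upd nu i a) _ mu mu' wf _ muE)) sa => j.
    by rewrite /upd; case: eqP => //= _ /nuE.
  apply: (proj2 (IHf _ _ _ (upd nu' i a) mu mu' wf _ muE)) sa => j.
  by rewrite /upd; case: eqP => [_ _|_ /nuE] //; rewrite hK.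
- move=> wf nuE muE; split=> [[A sA]|[A sA]]; exists (h @: A).
    apply: (proj1 (IHf _ _ nu nu' (upd mu X A) _ wf nuE _)) sA => Y.
    by rewrite /upd; case: eqP => //= _ /muE.
  apply: (proj2 (IHf _ _ nu nu' _ (upd mu' X A) wf nuE _)) sA => Y.
  by rewrite /upd; case: eqP => [_ _|_ /muE] //; rewrite involutive_imsetK.
Qed.

(* [h] exchanges [a] and [h a], so [phi a (h a)] and [phi (h a) a] are equivalent. *)
Lemma definable_order_rigid k phi (P : nat -> {set T}) a :
  mso_binary_formula k phi -> (forall X, X < k -> h @: P X = P X) ->
  linear_order (fun a b : T => sat R (pair_asg a b) P phi) -> h a = a.
Proof.
move=> wf hP [_ [anti [_ tot]]].
have swap : sat R (pair_asg a (h a)) P phi <-> sat R (pair_asg (h a) a) P phi.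
  apply: sat_automorphism wf _ _ => [i|X /hP-> //] _.
  by rewrite /pair_asg; case: eqP; rewrite ?hK.
by case: (tot a (h a)) => H; apply: anti => //; apply/swap.
Qed.
End Invariance.

(** * Labels and the exchange of twin vertices *)

(** The available bit positions: [(j, None)] concerns a vertex itself and [(j, Some w)] its edge to
    [w]. A label is a subset of this set. *)
Definition labels (k : nat) (T : finType) (W : {set T}) : {set 'I_k * option T} :=
  setX [set: 'I_k] (None |: [set Some w | w in W]).

Lemma card_labels k (T : finType) (W : {set T}) : #|labels k W| = k * #|W|.+1.
Proof.
rewrite cardsX cardsT card_ord cardsU1 card_imset; last by move=> ? ? [].
by case: imsetP => [[]|] // _; rewrite add1n.
Qed.

Lemma in_labels_Some k (T : finType) (W : {set T}) (j : 'I_k) w :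
  ((j, Some w) \in labels k W) = (w \in W).
Proof. by rewrite !inE /= mem_imset // => ? ? []. Qed.

Section Twins.
Variables (G : graph) (a b : gV G).
Hypothesis twin : forall w, gadj a w = gadj b w.

Definition twin_vertex v := if v == a then b else if v == b then a else v.

Lemma twin_vertexl : twin_vertex a = b. Proof. by rewrite /twin_vertex eqxx. Qed.
Lemma twin_vertexr : twin_vertex b = a. Proof. by rewrite /twin_vertex eqxx; case: eqP. Qed.
Lemma twin_vertexN v : v != a -> v != b -> twin_vertex v = v.
Proof. by rewrite /twin_vertex => /negPf-> /negPf->. Qed.

Lemma twin_vertexK : involutive twin_vertex.
Proof.
move=> v; case: (eqVneq v a) => [->|va]; first by rewrite twin_vertexl twin_vertexr.
case: (eqVneq v b) => [->|vb]; first by rewrite twin_vertexr twin_vertexl.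
by rewrite !twin_vertexN.
Qed.

Lemma twin_vertex_adj x y : gadj (twin_vertex x) (twin_vertex y) = gadj x y.
Proof.
have adj_sw u w : gadj (twin_vertex u) w = gadj u w.
  case: (eqVneq u a) => [->|ua]; first by rewrite twin_vertexl twin.
  case: (eqVneq u b) => [->|ub]; first by rewrite twin_vertexr twin.
  by rewrite twin_vertexN.
by rewrite adj_sw gadj_sym adj_sw gadj_sym.
Qed.

Lemma twin_vertex_edge (e : gE G) : is_edge (twin_vertex @: val e).
Proof.
case/existsP: (valP e) => x /existsP[y /andP[xy /eqP->]].
apply/existsP; exists (twin_vertex x); apply/existsP; exists (twin_vertex y).
by rewrite twin_vertex_adj xy imsetU1 imset_set1 eqxx.
Qed.

Definition twin_swap (t : inc_univ G) : inc_univ G :=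
  match t with
  | inl v => inl (twin_vertex v)
  | inr e => inr (Sub (twin_vertex @: val e) (twin_vertex_edge e))
  end.

Lemma twin_swapK : involutive twin_swap.
Proof.
case=> [v|e] /=; congr (_ _); first exact: twin_vertexK.
apply: val_inj; rewrite /= -imset_comp (eq_imset _ twin_vertexK); exact: imset_id.
Qed.

Lemma twin_swap_inc s t : inc (twin_swap s) (twin_swap t) = inc s t.
Proof.
case: s t => [v|e] [w|f] //=; rewrite mem_imset //; exact: inv_inj twin_vertexK.
Qed.

Lemma twin_swap_l : twin_swap (inl a) = inl b.
Proof. by rewrite /= twin_vertexl. Qed.

(** The swap moves only [a], [b] and the edges at them. Twins are not adjacent, so such an edge
    joins [a] or [b] to a third vertex [w], and its image is the edge from the other twin to [w]. *)
Lemma twin_swap_fix (P : {set inc_univ G}) :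
  (inl a \in P) = (inl b \in P) ->
  (forall (e f : gE G) w, gadj a w -> val e = [set a; w] -> val f = [set b; w] ->
    (inr e \in P) = (inr f \in P)) ->
  twin_swap @: P = P.
Proof.
move=> Pab Pe.
(* For an involution, closure of [P] already gives equality of [P] with its image. *)
have aux t : t \in P -> twin_swap t \in P.
  case: t => [v|e] /=.
    case: (eqVneq v a) => [->|va]; first by rewrite twin_vertexl Pab.
    case: (eqVneq v b) => [->|vb]; first by rewrite twin_vertexr Pab.
    by rewrite twin_vertexN.
  move=> eP; case: (boolP (a \in val e)) => [/edge_mem[w aw eE]|ae].
    have wa : w != a by apply: contraTneq aw => ->; rewrite gadj_irr.
    have wb : w != b by move: aw; rewrite twin; apply: contraTneq => ->; rewrite gadj_irr.
    by rewrite -(Pe e _ w) //= eE imsetU1 imset_set1 twin_vertexl twin_vertexN.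
  case: (boolP (b \in val e)) => [/edge_mem[w bw eE]|be].
    have aw : gadj a w by rewrite twin.
    have wa : w != a by apply: contraTneq aw => ->; rewrite gadj_irr.
    have wb : w != b by apply: contraTneq bw => ->; rewrite gadj_irr.
    by rewrite (Pe _ e w) //= eE imsetU1 imset_set1 twin_vertexr twin_vertexN.
  have -> // : Sub (twin_vertex @: val e) (twin_vertex_edge e) = e.
  apply: val_inj => /=; rewrite -[RHS]imset_id; apply: eq_in_imset => v ve.
  by apply: twin_vertexN; [apply: contraNneq ae => <- | apply: contraNneq be => <-].
apply/setP=> t; apply/imsetP/idP => [[u uP ->]|tP]; first exact: aux.
by exists (twin_swap t); [exact: aux | rewrite twin_swapK].
Qed.
End Twins.

(** * Counting labels in an orderable graph *)

Section OrderBound.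
Variables (G : graph) (d : nat) (part : gV G -> 'I_d).
Hypothesis part_witness : cmp_witness part.

Lemma part_size_le_of_order k phi (i : 'I_d) :
  mso_binary_formula k phi -> defines_order_on k phi (@inc G) ->
  part_size part i <= 2 ^ (k * (#|gV G| - part_size part i).+1).
Proof.
move=> wf ord; rewrite -card_outside_part -card_labels -card_powerset.
set A := [set v | part v == i].
(* An order is only promised on non-empty structures, so a vertex is needed to obtain the
   parameters. *)
case: (set_0Vmem A) => [A0|[v0 _]]; first by rewrite /part_size -/A A0 cards0.
have [P lin] := ord (inl v0).
pose ty v : {set 'I_k * option (gV G)} := [set c in labels k (~: A) |
  if c.2 is Some w then [exists e : gE G, (inr e \in P c.1) && (val e == [set v; w])]
  else inl v \in P c.1].
(* Injective labels give the bound; a collision yields twins whose swap fixes every parameter,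
   contradicting rigidity. *)
have [inj|] := @dinjectiveP _ _ ty (mem A).
  rewrite /part_size -/A -(card_in_imset inj).
  apply: subset_leq_card; apply/subsetP=> _ /imsetP[v _ ->].
  by rewrite inE; apply/subsetP=> c; rewrite inE => /andP[].
move=> ninj; exfalso; apply: ninj => a b aA bA tyE.
have part_ab : part a = part b by rewrite !inE in aA bA; rewrite (eqP aA) (eqP bA).
have twin w : gadj a w = gadj b w by rewrite !part_witness part_ab.
have fixP X : X < k -> twin_swap twin @: P X = P X.
  move=> Xk; apply: twin_swap_fix => [|e f w aw eE fE].
    by move/setP/(_ (Ordinal Xk, None)): tyE; rewrite !inE.
  move/setP/(_ (Ordinal Xk, Some w)): tyE; rewrite [LHS]inE [RHS]inE in_labels_Some.
  (* A neighbour of [a] lies outside the part of [a], so its bit is recorded in the label. *)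
  have -> : w \in ~: A.
    by rewrite !inE in aA *; rewrite part_witness (eqP aA) eq_sym in aw.
  have exE v (g : gE G) : val g = [set v; w] ->
      [exists e : gE G, (inr e \in P X) && (val e == [set v; w])] = (inr g \in P X).
    move=> gE; apply/existsP/idP => [[e' /andP[e'P]]|gP]; last by exists g; rewrite gP gE /=.
    by rewrite -gE => /eqP/val_inj <-.
  by rewrite /= (exE a e) // (exE b f).
have := definable_order_rigid (twin_swapK twin) (twin_swap_inc twin) (inl a) wf fixP lin.
by rewrite twin_swap_l => -[].
Qed.

Lemma max_part_bound_of_order k phi :
  mso_binary_formula k phi -> defines_order_on k phi (@inc G) ->
  let M := \max_(i < d) part_size part i in
  let N := \sum_(i < d) part_size part i in
  M <= 2 ^ (k * (N - M).+1).
Proof.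
move=> wf ord /=; case: (posnP d) => [d0|d_gt0].
  by rewrite [X in X <= _]big_pred0 // => i; have := ltn_ord i; rewrite [X in _ < X]d0.
have [|i ->] := eq_bigmax (part_size part); first by rewrite card_ord.
by rewrite sum_part_size; apply: part_size_le_of_order wf ord.
Qed.
End OrderBound.

(** * Boolean satisfaction and derived connectives *)

Fixpoint satb (T : finType) (R : rel T) (nu : nat -> T) (mu : nat -> {set T})
    (phi : mso) : bool :=
  match phi with
  | MRel i j => R (nu i) (nu j)
  | MEq i j => nu i == nu j
  | MMem i X => nu i \in mu X
  | MNeg f => ~~ satb R nu mu f
  | MAnd f g => satb R nu mu f && satb R nu mu g
  | MEx i f => [exists a : T, satb R (upd nu i a) mu f]
  | MExS X f => [exists A : {set T}, satb R nu (upd mu X A) f]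
  end.

Lemma satP (T : finType) (R : rel T) nu mu phi :
  reflect (sat R nu mu phi) (satb R nu mu phi).
Proof.
elim: phi nu mu => [i j|i j|i X|f IHf|f IHf g IHg|i f IHf|X f IHf] nu mu /=.
- exact: idP.
- exact: eqP.
- exact: idP.
- by apply: (iffP negP) => nf /IHf.
- by apply: (iffP andP) => -[/IHf ? /IHg ?].
- by apply: (iffP existsP) => -[a /IHf ?]; exists a.
- by apply: (iffP existsP) => -[a /IHf ?]; exists a.
Qed.

Definition MOr f g := MNeg (MAnd (MNeg f) (MNeg g)).
Definition MImp f g := MNeg (MAnd f (MNeg g)).
Definition MIff f g := MAnd (MImp f g) (MImp g f).
Definition MAll i f := MNeg (MEx i (MNeg f)).
Definition MAllS X f := MNeg (MExS X (MNeg f)).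

Section Connectives.
Variables (T : finType) (R : rel T) (nu : nat -> T) (mu : nat -> {set T}).
Local Notation satb := (@satb T R).

Lemma satbOr f g : satb nu mu (MOr f g) = satb nu mu f || satb nu mu g.
Proof. by rewrite /= negb_and !negbK. Qed.

Lemma satbImp f g : satb nu mu (MImp f g) = (satb nu mu f ==> satb nu mu g).
Proof. by rewrite /= negb_and negbK implybE. Qed.

Lemma satbIff f g : satb nu mu (MIff f g) = (satb nu mu f == satb nu mu g).
Proof. by rewrite [LHS]/= -!/(satb _ _ _); do 2!case: (satb _ _ _). Qed.

Lemma satbAll i f : satb nu mu (MAll i f) = [forall a, satb (upd nu i a) mu f].
Proof. by rewrite /= negb_exists; apply: eq_forallb => a; rewrite negbK. Qed.

Lemma satbAllS X f :
  satb nu mu (MAllS X f) = [forall A : {set T}, satb nu (upd mu X A) f].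
Proof. by rewrite /= negb_exists; apply: eq_forallb => A; rewrite negbK. Qed.

Lemma satbNeg f : satb nu mu (MNeg f) = ~~ satb nu mu f.
Proof. by []. Qed.
Lemma satbAnd f g : satb nu mu (MAnd f g) = satb nu mu f && satb nu mu g.
Proof. by []. Qed.
Lemma satbEx i f : satb nu mu (MEx i f) = [exists a, satb (upd nu i a) mu f].
Proof. by []. Qed.
Lemma satbRel i j : satb nu mu (MRel i j) = R (nu i) (nu j).
Proof. by []. Qed.
Lemma satbEq i j : satb nu mu (MEq i j) = (nu i == nu j).
Proof. by []. Qed.
Lemma satbMem i X : satb nu mu (MMem i X) = (nu i \in mu X).
Proof. by []. Qed.
End Connectives.

Definition satbE := (satbOr, satbImp, satbIff, satbAll, satbAllS,
  satbNeg, satbAnd, satbEx, satbRel, satbEq, satbMem).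

(** * The ordering formula *)

(* Set variables: 0 holds the vertices of a path, 1 its edges, 2 the vertices and
   edges at even positions (which orients the path), 3 is bound in [path_lt], and
   [4 + 2j], [5 + 2j] hold the vertex and edge labels. First-order variables: 0
   and 1 are compared, 2 and 3 range over the path, the others are local. *)
Definition next_fm x y : mso :=
  MEx 6 (MAnd (MRel x 6) (MAnd (MRel y 6) (MAnd (MMem 6 1)
    (MAnd (MIff (MMem x 2) (MMem 6 2)) (MIff (MMem y 2) (MNeg (MMem 6 2))))))).

(** Reachability in second-order form: [y] lies in every set that contains [x] and is closed under
    successors. *)
Definition path_lt x y : mso :=
  MAnd (MNeg (MEq x y))
    (MAllS 3 (MImp (MAnd (MMem x 3)
        (MAll 4 (MAll 5 (MImp (MAnd (MMem 4 3) (next_fm 4 5)) (MMem 5 3)))))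
      (MMem y 3))).

(** Strict lexicographic comparison of two bit strings indexed by the path: at the first difference
    [x] has 0 and [y] has 1. *)
Definition cmp_fm (beta : nat -> nat -> mso) x y : mso :=
  MEx 2 (MAnd (MMem 2 0) (MAnd (beta y 2) (MAnd (MNeg (beta x 2))
    (MAll 3 (MImp (MAnd (MMem 3 0) (path_lt 3 2)) (MIff (beta x 3) (beta y 3))))))).

(** A vertex counts as its own endpoint, so that vertices and edges are treated uniformly. *)
Definition endpoint_fm r x : mso := MOr (MEq r x) (MRel r x).

Definition edge_bit x (u : nat) : mso := MEx 7 (MRel 7 x).
Definition inc_bit x u : mso := endpoint_fm u x.
Definition vlabel_bit X x (u : nat) : mso :=
  MEx 7 (MAnd (endpoint_fm 7 x) (MMem 7 X)).
Definition elabel_bit X x u : mso :=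
  MEx 7 (MAnd (endpoint_fm 7 x) (MAnd (MNeg (MMem 7 0))
    (MEx 8 (MAnd (MMem 8 X) (MAnd (MRel 7 8) (MRel u 8)))))).

(** Bit 0 tells edges from vertices, bit 1 gives the endpoints on the path, and the remaining bits
    alternate between vertex and edge labels, read from set variables 4, 5, and so on. *)
Definition bit_fm i : nat -> nat -> mso :=
  match i with
  | 0 => edge_bit
  | 1 => inc_bit
  | j.+2 => (if odd j then elabel_bit else vlabel_bit) j.+4
  end.

Definition lex_fm (l : seq nat) x y : mso :=
  foldr (fun i f => MOr (cmp_fm (bit_fm i) x y) (MAnd (MNeg (cmp_fm (bit_fm i) y x)) f))
    (* Falsity: with nothing left to compare, the strict order fails. *)
    (MNeg (MEq x x)) l.

Definition order_fm s : mso := MNeg (lex_fm (iota 0 s.*2.+2) 1 0).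

Lemma bit_fm_wf (fb : pred nat) k i x u : 3 < k -> i.+2 < k -> fb x -> fb u ->
  mso_wf fb (fun n => n < k) (bit_fm i x u).
Proof.
move=> k4 ik fbx fbu; have k0 : 0 < k by apply: leq_trans k4.
case: i ik => [|[|j]] jk /=; rewrite ?fbx ?fbu ?orbT //.
by case: odd; rewrite /= fbx ?fbu ?orbT ?k0 jk.
Qed.

Lemma lex_fm_wf k l x y : 3 < k -> x < 2 -> y < 2 -> {in l, forall i, i.+2 < k} ->
  mso_wf (fun n => n < 2) (fun n => n < k) (lex_fm l x y).
Proof.
move=> k4 x2 y2.
have [k1 k2 k3] : [/\ 0 < k, 1 < k & 2 < k] by rewrite !(leq_trans _ k4).
elim: l => [|i l IHl] lk; first by rewrite /= x2.
have ik := lk i (mem_head _ _); move/IHl: (sub_in1 (mem_behead (s := i :: l)) lk).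
by move=> /= ->; rewrite !bit_fm_wf //= ?k1 ?k2 ?k3 ?x2 ?y2 ?orbT.
Qed.

Lemma order_fm_wf s : mso_binary_formula s.*2.+4 (order_fm s).
Proof.
rewrite /mso_binary_formula -[mso_wf _ _ _]/(mso_wf _ _ (lex_fm (iota 0 s.*2.+2) 1 0)).
by apply: lex_fm_wf => // i; rewrite mem_iota.
Qed.

(** * Semantics of the ordering formula *)

Section BinaryValue.
Variable T : eqType.
Implicit Types (f g : pred T) (p : seq T).

(** The head of [p] carries the most significant bit, so lexicographic comparison along [p] becomes
    comparison of numbers. *)
Fixpoint bits_val f p : nat :=
  if p is u :: p' then f u * 2 ^ size p' + bits_val f p' else 0.

Lemma bits_val_lt f p : bits_val f p < 2 ^ size p.
Proof.
elim: p => //= u p IHp; rewrite expnS mul2n -addnn -addnS leq_add //.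
by case: (f u); rewrite ?mul1n.
Qed.

Lemma bits_val_cmp f g u p :
  (bits_val f (u :: p) < bits_val g (u :: p)) =
  ~~ f u && g u || (f u == g u) && (bits_val f p < bits_val g p).
Proof.
have := (bits_val_lt f p, bits_val_lt g p) => -[ltf ltg] /=.
case: (f u) (g u) => [] [] /=; rewrite ?mul1n ?mul0n ?add0n ?orbF.
- by rewrite ltn_add2l.
- by rewrite ltnNge (leq_trans (ltnW ltg)) // leq_addr.
- by rewrite (leq_trans ltf) // leq_addr.
- by [].
Qed.

Lemma bits_val_ltP f g p : uniq p ->
  reflect (exists2 u, u \in p & [/\ g u, ~~ f u &
             forall v, v \in p -> index v p < index u p -> f v = g v])
          (bits_val f p < bits_val g p).
Proof.
elim: p => [_|a p IHp /= /andP[ap /IHp{}IHp]]; first by constructor=> -[].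
rewrite -[_ < _]/(bits_val f (a :: p) < bits_val g (a :: p)) bits_val_cmp.
apply: (iffP orP) => [[/andP[nfa ga]|/andP[/eqP fga /IHp[u up [gu nfu agree]]]]|].
- by exists a; rewrite ?mem_head //; split=> // v _; rewrite eqxx.
- exists u; rewrite ?inE ?up ?orbT //; split=> // v.
  rewrite inE => /predU1P[-> //|vp]; move: (agree v vp).
  by rewrite !ifN ?ltnS //; [apply: contraNneq ap => -> | apply: contraNneq ap => ->].
- case=> u; rewrite inE => /predU1P[-> [ga nfa _]|up [gu nfu agree]].
    by left; rewrite nfa ga.
  have au : a != u by apply: contraNneq ap => ->.
  right; rewrite (agree a) ?mem_head ?eqxx ?(negPf au) //=; apply/IHp.
  exists u => //; split=> // v vp ltvu; apply: agree; rewrite ?inE ?vp ?orbT //.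
  by rewrite (negPf au) ifN ?ltnS //; apply: contraNneq ap => ->.
Qed.

Lemma bits_val_eqP f g p : bits_val f p = bits_val g p -> {in p, f =1 g}.
Proof.
elim: p => //= a p IHp E.
have [fga] : f a = g a /\ bits_val f p = bits_val g p.
  have := (bits_val_lt f p, bits_val_lt g p) => -[ltf ltg].
  move: E; case: (f a) (g a) => [] []; rewrite ?mul1n ?mul0n ?add0n //.
  - by move/addnI.
  - by move=> E; move: ltg; rewrite -E ltnNge leq_addr.
  - by move=> E; move: ltf; rewrite E ltnNge leq_addr.
by move/IHp => agree v; rewrite inE => /predU1P[->|/agree].
Qed.
End BinaryValue.

Section OrderSemantics.
Variables (T : finType) (R : rel T) (mu : nat -> {set T}) (p : seq T).

Definition next_rel x y : bool :=
  [exists e, [&& R x e, R y e, e \in mu 1, (x \in mu 2) == (e \in mu 2)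
               & (y \in mu 2) == (e \notin mu 2)]].

Hypotheses (p_uniq : uniq p) (mu0 : mu 0 =i p)
  (next_relE : forall x y, next_rel x y =
     [&& x \in p, y \in p & index y p == (index x p).+1]).

Lemma satb_path_lt nu : nu 2 \in p -> nu 3 \in p ->
  satb R nu mu (path_lt 3 2) = (index (nu 3) p < index (nu 2) p).
Proof.
move=> p2 p3; rewrite /path_lt !satbE ltn_neqAle; congr (_ && _).
  by rewrite (inj_in_eq (@index_inj _ (nu 2) p)).
transitivity [forall A : {set T},
    ((nu 3 \in A) && [forall x, forall y, (x \in A) && next_rel x y ==> (y \in A)])
    ==> (nu 2 \in A)].
  apply: eq_forallb => A; rewrite !satbE.
  congr ((_ && _) ==> _); apply: eq_forallb => x; rewrite satbE.
  apply: eq_forallb => y; rewrite !satbE; congr ((_ && _) ==> _).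
  by rewrite /next_rel; apply: eq_existsb => e; rewrite !satbE.
(* The test set is the final segment starting at [nu 3]; conversely a closed set is followed step by
   step along the path. *)
apply/forallP/idP => [/(_ [set x | index (nu 3) p <= index x p])|le32 A].
  rewrite !inE leqnn => /implyP; apply; apply/forallP=> x; apply/forallP=> y.
  apply/implyP; rewrite !inE next_relE => /and3P[lex _ /andP[_ /eqP->]].
  exact: leqW.
apply/implyP=> /andP[A3 /forallP closed].
suff H n : index (nu 3) p + n < size p -> nth (nu 3) p (index (nu 3) p + n) \in A.
  by rewrite -(nth_index (nu 3) p2) -(subnKC le32) H // subnKC ?index_mem.
elim: n => [|n IHn] lt_n; first by rewrite addn0 nth_index.
have lt_n' : index (nu 3) p + n < size p by apply: ltnW; rewrite -addnS.
have /forallP/(_ (nth (nu 3) p (index (nu 3) p + n.+1)))/implyP :=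
  closed (nth (nu 3) p (index (nu 3) p + n)).
by apply; rewrite IHn // next_relE !mem_nth // !index_uniq // addnS eqxx.
Qed.

(** The ranges of [x] and [u] keep them apart from the local variables 7 and 8 bound inside the
    bits. *)
Definition interprets (beta : nat -> nat -> mso) (B : T -> T -> bool) : Prop :=
  forall nu x u, x < 2 -> 1 < u < 4 -> satb R nu mu (beta x u) = B (nu x) (nu u).

Lemma satb_cmp beta B nu x y : interprets beta B -> x < 2 -> y < 2 ->
  satb R nu mu (cmp_fm beta x y) = (bits_val (B (nu x)) p < bits_val (B (nu y)) p).
Proof.
move=> betaB x2 y2; transitivity [exists u, [&& u \in mu 0, B (nu y) u, ~~ B (nu x) u &
    [forall v, (v \in mu 0) && satb R (upd (upd nu 2 u) 3 v) mu (path_lt 3 2) ==>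
       (B (nu x) v == B (nu y) v)]]].
  rewrite satbEx; apply: eq_existsb => u; rewrite !satbAnd satbNeg satbAll !betaB //.
  congr [&& _, _, _ & _]; [by case: y y2 => [|[]] | by case: x x2 => [|[]] |].
  apply: eq_forallb => v; rewrite satbImp satbAnd satbIff !betaB //.
  by case: x x2 => [|[|//]] _; case: y y2 => [|[]].
apply/existsP/(bits_val_ltP _ _ p_uniq) => [[u]|[u up [By Bx agree]]].
  rewrite mu0 => /and4P[up By Bx /forallP agree].
  exists u => //; split=> // v vp ltvu; apply/eqP; apply: (implyP (agree v)).
  by rewrite mu0 vp satb_path_lt.
exists u; rewrite mu0 up By Bx; apply/forallP=> v; apply/implyP.
rewrite mu0 => /andP[vp]; rewrite satb_path_lt // => ltvu.
by rewrite (agree v vp ltvu).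
Qed.

(* A lexicographic combination of finitely many rankings is again a ranking. *)
Lemma satb_lex (B : nat -> T -> T -> bool) l :
  (forall i, interprets (bit_fm i) (B i)) ->
  exists2 F : T -> nat,
    forall nu x y, x < 2 -> y < 2 ->
      satb R nu mu (lex_fm l x y) = (F (nu x) < F (nu y)) &
    forall a b, F a = F b -> forall i, i \in l -> {in p, B i a =1 B i b}.
Proof.
move=> interpB; elim: l => [|i l [F lexF injF]].
  by exists (fun=> 0) => // nu x y _ _; rewrite /= eqxx.
(* [K] exceeds all values of [F], so [rank a * K + F a] compares by [rank] first and by [F] on
   ties. *)
pose K := (\max_a F a).+1.
have ltFK a : F a < K by rewrite ltnS leq_bigmax.
pose rank a := bits_val (B i a) p.
have cmpE m n a b : a < K -> b < K ->
    (m * K + a < n * K + b) = (m < n) || ~~ (n < m) && (a < b).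
  move=> aK bK; case: (ltngtP m n) => [lt|lt|->] /=; last by rewrite ltn_add2l.
    apply: leq_trans (leq_addr _ _); apply: leq_trans (_ : m.+1 * K <= _).
      by rewrite mulSn addnC ltn_add2r.
    by rewrite leq_mul2r lt orbT.
  apply/negbTE; rewrite -leqNgt; apply: leq_trans (leq_addr _ _).
  apply: leq_trans (_ : n.+1 * K <= _).
    by rewrite mulSn addnC leq_add2r ltnW.
  by rewrite leq_mul2r lt orbT.
exists (fun a => rank a * K + F a) => [nu x y x2 y2|a b E j].
  by rewrite [LHS]satbOr satbAnd satbNeg lexF // !(satb_cmp _ (interpB i)) // cmpE.
have rab : rank a = rank b.
  by move/(congr1 (divn^~ K)): E; rewrite !divnMDl // !divn_small // !addn0.
rewrite inE => /predU1P[->|]; first exact: bits_val_eqP.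
by apply: injF; move/eqP: E; rewrite rab eqn_add2l => /eqP.
Qed.

Definition endpoint (r x : T) : bool := (r == x) || R r x.

Definition bit_rel i (x u : T) : bool :=
  match i with
  | 0 => [exists r, R r x]
  | 1 => endpoint u x
  | j.+2 =>
      if odd j then
        [exists r, [&& endpoint r x, r \notin mu 0 &
          [exists e, [&& e \in mu j.+4, R r e & R u e]]]]
      else [exists r, endpoint r x && (r \in mu j.+4)]
  end.

Lemma bit_fm_interprets i : interprets (bit_fm i) (bit_rel i).
Proof.
move=> nu x u x2 u24; case: i => [|[|j]].
- by apply: eq_existsb => r; case: x x2 => [|[|//]].
- by rewrite [LHS]satbOr.
rewrite /bit_fm /bit_rel; case: odd; rewrite [LHS]satbEx; apply: eq_existsb => r;
  rewrite satbAnd [X in X && _]satbOr.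
- by case: x x2 => [|[|//]] _; case: u u24 => [|[|[|[|u]]]].
- by case: x x2 => [|[|//]].
Qed.

Lemma order_fm_linear s :
  (forall a b, (forall i, i < s.*2.+2 -> {in p, bit_rel i a =1 bit_rel i b}) -> a = b) ->
  linear_order (fun a b => sat R (pair_asg a b) mu (order_fm s)).
Proof.
move=> inj.
have [F lexF injF] := satb_lex (iota 0 s.*2.+2) bit_fm_interprets.
have ordE a b : sat R (pair_asg a b) mu (order_fm s) <-> F a <= F b.
  by rewrite leqNgt -(lexF (pair_asg a b) 1 0) //; apply: rwP; apply: satP.
split=> [a|]; first exact/ordE.
split=> [a b /ordE ab /ordE ba|].
  apply: inj => i ltis; apply: injF; last by rewrite mem_iota.
  by apply/eqP; rewrite eqn_leq ab ba.
split=> [a b c /ordE ab /ordE bc|a b]; first by apply/ordE; apply: leq_trans bc.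
by case/orP: (leq_total (F a) (F b)) => ?; [left|right]; apply/ordE.
Qed.
End OrderSemantics.

(** * Parameters for a complete multipartite graph *)

(** Prepending vertices must stop, since a duplicate-free path has at most [#|T|] of them. *)
Lemma maximal_path (T : finType) (e : rel T) (v0 : T) :
  exists z p, [/\ path e z p, uniq (z :: p) &
    forall v, v \notin z :: p -> ~~ e v z].
Proof.
suff H n z p : path e z p -> uniq (z :: p) -> #|T| - size (z :: p) <= n ->
    exists z p, [/\ path e z p, uniq (z :: p) & forall v, v \notin z :: p -> ~~ e v z].
  exact: (H _ v0 [::]).
elim: n z p => [|n IHn] z p pz uz.
  rewrite leqn0 subn_eq0 -(card_uniqP uz) => full; exists z, p; split=> // v.
  have /eqP/subset_cardP/(_ (subset_predT _))-> // : #|z :: p| == #|T|.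
  by rewrite eqn_leq max_card full.
case: (pickP [pred v | (v \notin z :: p) && e v z]) => [v /andP[vp vz] le_n|no _].
  apply: (IHn v (z :: p)); rewrite /= ?vz //; first by rewrite vp; move: uz => /= ->.
  by move: le_n; rewrite /= [_ - (size p).+2]subnS; case: (_ - _).
by exists z, p; split=> // v vp; move: (no v); rewrite /= vp /= => ->.
Qed.

Lemma exists_injection_in (T U : finType) (b0 : U) (A : {set T}) (B : {set U}) :
  #|A| <= #|B| -> exists2 f : T -> U, {in A &, injective f} & {in A, forall x, f x \in B}.
Proof.
move=> leAB.
have idx x : x \in A -> index x (enum A) < size (enum B).
  by move=> xA; rewrite -cardE; apply: leq_trans leAB; rewrite cardE index_mem mem_enum.
exists (fun x => nth b0 (enum B) (index x (enum A))) => [x y xA yA /eqP|x xA].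
  rewrite nth_uniq ?enum_uniq ?idx // => /eqP/(index_inj x).
  by apply; rewrite ?mem_enum.
by rewrite -mem_enum mem_nth ?idx.
Qed.

Section OrderedGraph.
Variables (G : graph) (d : nat) (part : gV G -> 'I_d).
Hypothesis part_witness : cmp_witness part.
Variables (z : gV G) (p' : seq (gV G)).
Let p := z :: p'.
Hypotheses (p_path : path (@gadj G) z p') (p_uniq : uniq p)
  (p_max : forall v, v \notin p -> ~~ gadj v z).
Let I := [set v | part v == part z].
Variables (s : nat) (code : gV G -> {set 'I_s * option (gV G)}).
Hypotheses (code_inj : {in I &, injective code})
  (code_labels : {in I, forall v, code v \in powerset (labels s (~: I))}).

Lemma code_labels_sub v : v \in I -> code v \subset labels s (~: I).
Proof. by move/code_labels; rewrite inE. Qed.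

Definition path_next u v := [&& u \in p, v \in p & index v p == (index u p).+1].

(** The index is a plain natural because set variables are numbered by naturals; it is false beyond
    [s]. *)
Definition has_label v (j : nat) o := [exists i : 'I_s, (i == j :> nat) && ((i, o) \in code v)].

(** In set 2 a path edge inherits the parity of its earlier endpoint, from which [next_fm] recovers
    its direction. A bit [(i, Some w)] of [code r] is stored on the edge from [r] to [w]. *)
Definition order_params (X : nat) : {set inc_univ G} :=
  match X with
  | 0 => [set t : inc_univ G | if t is inl v then v \in p else false]
  | 1 => [set t : inc_univ G | if t is inr e then
      [exists u in val e, exists v in val e, path_next u v] else false]
  | 2 => [set t : inc_univ G | match t with
      | inl v => ~~ odd (index v p)
      | inr e => [exists u in val e, exists v in val e, path_next u v && ~~ odd (index u p)]
      end]
  | j.+4 => [set t : inc_univ G | match t with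
      | inl r => [&& ~~ odd j, r \notin p & has_label r j./2 None]
      | inr e => odd j && [exists r in val e, exists w in val e,
          [&& r \notin p, w \in p & has_label r j./2 (Some w)]]
      end]
  | _ => set0
  end.

Local Notation mu := order_params.
Let pT : seq (inc_univ G) := map inl p.

Lemma inl_inj : injective (inl : gV G -> inc_univ G).
Proof. by move=> ? ? []. Qed.

Lemma mem_pT v : (inl v \in pT) = (v \in p).
Proof. by rewrite mem_map //; exact: inl_inj. Qed.

Lemma inr_pT e : (inr e \in pT) = false.
Proof. by apply/mapP => -[]. Qed.

Lemma index_pT v : index (inl v) pT = index v p.
Proof. by rewrite index_map //; exact: inl_inj. Qed.

(** Maximality makes [v] non-adjacent to [z], which here means being in the same part. *)
Lemma off_path_part v : v \notin p -> v \in I.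
Proof. by move/p_max; rewrite part_witness negbK inE. Qed.

Lemma has_labelE v (i : 'I_s) o : has_label v i o = ((i, o) \in code v).
Proof.
apply/existsP/idP => [[i' /andP[/eqP/val_inj-> //]]|io]; exists i.
by rewrite eqxx.
Qed.

Lemma path_next_adj u v : path_next u v -> gadj u v.
Proof.
case/and3P=> up vp /eqP iv.
have := (pathP z p_path) (index u p).
rewrite -[nth z p' _]/(nth z p (index u p).+1) -iv !nth_index // => -> //.
by move: vp; rewrite -index_mem iv.
Qed.

Lemma path_next_edge u v (e : gE G) : path_next u v -> u \in val e -> v \in val e ->
  val e = [set u; v].
Proof.
move=> uv ue ve; have [w _ eE] := edge_mem ue.
move: ve; rewrite eE !inE => /orP[] /eqP vu; last by rewrite vu.
by move: uv; rewrite /path_next vu; case/and3P=> _ _ /eqP/n_Sn.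
Qed.

(** Traversing [e] both ways would make an index exceed itself by two. *)
Lemma path_next_start u v u' v' (e : gE G) : path_next u v -> path_next u' v' ->
  u \in val e -> v \in val e -> u' \in val e -> v' \in val e -> u' = u.
Proof.
move=> uv uv' ue ve; rewrite (path_next_edge uv ue ve) !inE.
case/orP=> /eqP u'E // /orP[] /eqP v'E; last first.
  by move: uv'; rewrite /path_next u'E v'E => /and3P[_ _ /eqP/n_Sn].
move: uv uv'; rewrite /path_next u'E v'E => /and3P[_ _ /eqP->] /and3P[_ _ /eqP].
by move/eqP; rewrite ltn_eqF // ltnW.
Qed.

Lemma path_next_even u v (e : gE G) :
  path_next u v -> u \in val e -> v \in val e ->
  [exists u in val e, exists v in val e, path_next u v && ~~ odd (index u p)] =
  ~~ odd (index u p).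
Proof.
move=> uv ue ve.
apply/exists_inP/idP => [[u' u'e /exists_inP[v' v'e /andP[uv' odd_u']]]|odd_u].
  by rewrite -(path_next_start uv uv' ue ve u'e v'e).
by exists u => //; apply/exists_inP; exists v => //; rewrite uv.
Qed.

Lemma order_params_next x y : next_rel (@inc G) mu x y =
  [&& x \in pT, y \in pT & index y pT == (index x pT).+1].
Proof.
case: x => [x|f]; last first.
  by rewrite inr_pT; apply/existsP => -[e /and5P[]].
case: y => [y|f]; last first.
  by rewrite inr_pT andbF; apply/existsP => -[e /and5P[_]].
rewrite !mem_pT !index_pT -/(path_next x y); apply/existsP/idP => [[[//|e]]|xy].
  case/and5P=> /= xe ye; rewrite !inE => /exists_inP[u ue /exists_inP[v ve uv]].
  have eE := path_next_edge uv ue ve.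
  rewrite (path_next_even uv ue ve).
  have odd_v : odd (index v p) = ~~ odd (index u p).
    by case/and3P: uv => _ _ /eqP->.
  (* Of the four ways to place [x] and [y] on the edge, only [x = u], [y = v] meets both parity
     conditions. *)
  move: xe ye; rewrite eE !inE => /orP[] /eqP-> /orP[] /eqP-> //;
    by rewrite ?odd_v; case: odd.
have [e eE] := edge_of_adj (path_next_adj xy).
have xe : x \in val e by rewrite eE !inE eqxx.
have ye : y \in val e by rewrite eE !inE eqxx orbT.
exists (inr e); rewrite /= xe ye !inE (path_next_even xy xe ye) eqxx /=.
have -> : [exists u in val e, exists v in val e, path_next u v].
  by apply/exists_inP; exists x => //; apply/exists_inP; exists y.
by case/and3P: xy => _ _ /eqP; rewrite /= => ->; rewrite eqxx.
Qed.

Definition verts (t : inc_univ G) : {set gV G} :=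
  match t with inl v => [set v] | inr e => val e end.

Definition is_inr (t : inc_univ G) : bool := if t is inr _ then true else false.

Lemma endpoint_inl v t : endpoint (@inc G) (inl v) t = (v \in verts t).
Proof.
by case: t => [w|e]; rewrite /endpoint ?orbF //= inE; apply/eqP/eqP => [[]|->].
Qed.

Lemma bit_edge t u : bit_rel (@inc G) mu 0 t u = is_inr t.
Proof.
case: t => [v|e] /=; first by apply/existsP => -[[]].
case/existsP: (valP e) => x /existsP[y /andP[_ /eqP eE]].
by apply/existsP; exists (inl x); rewrite /= eE !inE eqxx.
Qed.

Lemma bit_inc t u : bit_rel (@inc G) mu 1 t (inl u) = (u \in verts t).
Proof. exact: endpoint_inl. Qed.

Lemma bit_vlabel (i : 'I_s) t u : bit_rel (@inc G) mu i.*2.+2 t u =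
  [exists r in verts t, (r \notin p) && ((i, None) \in code r)].
Proof.
rewrite /= odd_double; apply/existsP/exists_inP => [[[r|e]]|[r rt]].
- rewrite endpoint_inl inE doubleK has_labelE => /and3P[rt _ rl]; by exists r.
- by rewrite inE /= andbF.
- by exists (inl r); rewrite endpoint_inl rt inE /= doubleK has_labelE.
Qed.

Lemma bit_elabel (i : 'I_s) t u : u \in p ->
  bit_rel (@inc G) mu i.*2.+3 t (inl u) =
  [exists r in verts t, (r \notin p) && ((i, Some u) \in code r)].
Proof.
move=> up; rewrite [LHS]/= odd_double; apply/existsP/exists_inP => [[[r|f]]|[r rt]].
- rewrite endpoint_inl inE => /and3P[rt rp /existsP[[v|e]]]; first by case/and3P.
  case/and3P=> /=; rewrite inE /= uphalf_double.
  (* The edge has two ends, one off the path and one on it; hence [r' = r] and [w = u]. *)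
  case/exists_inP=> r' r'e /exists_inP[w we /and3P[r'p wp lab]] re ue.
  have [w' _ eE] := edge_mem re; move: r'e we ue; rewrite eE !inE.
  have neq x y : x \notin p -> y \in p -> (y == x) = false.
    by move=> xp yp; apply: contraNF xp => /eqP<-.
  rewrite (neq r w) // (neq r u) //= => r'E /eqP wE /eqP uE.
  rewrite -wE [r' == w]eq_sym (neq r' w) // orbF in r'E.
  by exists r => //; rewrite rp -has_labelE -(eqP r'E) uE -wE.
- by case/and3P=> _ _ /existsP[e /and3P[]].
- case/andP=> rp lab; have rI := off_path_part rp.
  have ur : gadj r u.
    have := subsetP (code_labels_sub rI) _ lab.
    by rewrite in_labels_Some !inE part_witness; rewrite inE in rI; rewrite (eqP rI) eq_sym.
  have [e eE] := edge_of_adj ur.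
  have re : r \in val e by rewrite eE !inE eqxx.
  have ue : u \in val e by rewrite eE !inE eqxx orbT.
  exists (inl r); rewrite endpoint_inl rt inE rp; apply/existsP; exists (inr e).
  rewrite /= re ue inE /= uphalf_double !andbT.
  by apply/exists_inP; exists r => //; apply/exists_inP; exists u; rewrite // rp up has_labelE.
Qed.

Lemma card_verts t : #|verts t| = (is_inr t).+1.
Proof.
case: t => [v|e] /=; first by rewrite cards1.
case/existsP: (valP e) => x /existsP[y /andP[xy /eqP->]].
by rewrite cards2; case: eqP xy => // ->; rewrite gadj_irr.
Qed.

(** Off-path vertices share the part of [z], so no edge joins two of them. *)
Lemma verts_off_path t r r' : r \in verts t -> r \notin p ->
  r' \in verts t -> r' \notin p -> r' = r.
Proof.
case: t => [v|e] /=; first by rewrite !inE => /eqP-> _ /eqP->.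
move=> re /off_path_part rI r'e /off_path_part r'I.
have [w rw eE] := edge_mem re; move: r'e; rewrite eE !inE => /orP[] /eqP // r'w.
move: rw; rewrite -r'w part_witness; rewrite !inE in rI r'I.
by rewrite (eqP rI) (eqP r'I) eqxx.
Qed.

Lemma order_params_separate a b :
  (forall i, i < s.*2.+2 -> {in pT, bit_rel (@inc G) mu i a =1 bit_rel (@inc G) mu i b}) ->
  a = b.
Proof.
(* Bits that do not depend on the path position are read at [z]. *)
move=> agree; have zp : inl z \in pT by rewrite mem_pT mem_head.
have edge_ab := agree 0 isT _ zp; rewrite !bit_edge in edge_ab.
suff vertsE : verts a = verts b.
  case: a b edge_ab vertsE {agree} => [v|e] [w|f] //= _; last by move/val_inj->.
  by move/set1_inj->.
have onE : verts a :&: [set v in p] = verts b :&: [set v in p].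
  apply/setP=> v; rewrite !in_setI in_set; case vp: (v \in p); rewrite ?andbF // !andbT.
  by rewrite -!bit_inc agree // mem_pT.
suff offE : verts a :\: [set v in p] = verts b :\: [set v in p].
  by rewrite -(setID (verts a) [set v in p]) onE offE setID.
(* Same kind and same ends on the path leave equally many ends off it, namely none or one. *)
have cardE : #|verts a :\: [set v in p]| = #|verts b :\: [set v in p]|.
  by rewrite !cardsD onE !card_verts edge_ab.
have off1 t r : r \in verts t :\: [set v in p] -> verts t :\: [set v in p] = [set r].
  rewrite in_setD in_set => /andP[rp rt]; apply/setP=> v; rewrite in_setD in_set in_set1.
  apply/andP/eqP => [[vp vt]|-> //]; exact: (verts_off_path rt rp vt vp).
case: (set_0Vmem (verts a :\: [set v in p])) => [a0|[r ra]].
  by rewrite a0; apply/esym/eqP; rewrite -cards_eq0 -cardE a0 cards0.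
have [r' rb] : exists r', r' \in verts b :\: [set v in p].
  by apply/card_gt0P; rewrite -cardE; apply/card_gt0P; exists r.
rewrite (off1 _ _ ra) (off1 _ _ rb); congr [set _].
have labE t q (P : pred (gV G)) : q \in verts t :\: [set v in p] ->
    [exists r in verts t, (r \notin p) && P r] = P q.
  move=> qt; apply/exists_inP/idP => [[x xt /andP[xp Px]]|Pq].
    by move: (qt); rewrite in_setD in_set => /andP[qp qt']; rewrite -(verts_off_path qt' qp xt xp).
  by move: qt; rewrite in_setD in_set => /andP[qp qt]; exists q; rewrite ?qp.
have rI : r \in I by move: ra; rewrite in_setD in_set => /andP[/off_path_part].
have r'I : r' \in I by move: rb; rewrite in_setD in_set => /andP[/off_path_part].
apply: code_inj => //; apply/setP=> -[i [w|]]; last first.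
  rewrite -(labE a r (fun x => (i, None) \in code x)) //.
  rewrite -(labE b r' (fun x => (i, None) \in code x)) //.
  rewrite -!(bit_vlabel i _ (inl z)); apply: agree => //.
  by rewrite !ltnS ltn_double.
(* Outside [I] the vertex [w] is on the path and its bit is compared there; inside [I] no code
   contains it. *)
case wI: (w \in I); last first.
  have wp : w \in p by apply: contraFT wI => /off_path_part.
  rewrite -(labE a r (fun x => (i, Some w) \in code x)) //.
  rewrite -(labE b r' (fun x => (i, Some w) \in code x)) //.
  rewrite -!bit_elabel //; apply: agree; rewrite ?mem_pT //.
  by rewrite !ltnS ltn_Sdouble.
have nolab x : x \in I -> (i, Some w) \in code x = false.
  move=> xI; apply/negP=> /(subsetP (code_labels_sub xI)).
  by rewrite in_labels_Some in_setC wI.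
by rewrite !nolab.
Qed.

Lemma order_params_linear :
  linear_order (fun a b => sat (@inc G) (pair_asg a b) mu (order_fm s)).
Proof.
apply: (@order_fm_linear _ _ _ pT); last exact: order_params_separate.
- by rewrite map_inj_uniq //; exact: inl_inj.
- by case=> [v|e]; rewrite inE ?mem_pT ?inr_pT.
- exact: order_params_next.
Qed.

End OrderedGraph.

(** * From the size bound to an order, and the equivalences *)

Lemma order_fm_defines_order (G : graph) (d : nat) (part : gV G -> 'I_d) s :
  cmp_witness part ->
  \max_(i < d) part_size part i <=
    2 ^ (s * (\sum_(i < d) part_size part i - \max_(i < d) part_size part i).+1) ->
  defines_order_on s.*2.+4 (order_fm s) (@inc G).
Proof.
move=> wit bound t0.
have [v0 _] : exists v0 : gV G, True.
  by case: t0 => [v|[e /existsP[v _]]]; exists v.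
have [z [p [p_path p_uniq p_max]]] := maximal_path (@gadj G) v0.
have [|code code_inj code_labels] :=
  @exists_injection_in _ _ set0 [set v | part v == part z]
    (powerset (labels s (~: [set v | part v == part z]))).
  (* The part of [z] may be smaller than [M]; it then has more outside vertices than [N - M], hence
     still enough labels. *)
  rewrite card_powerset card_labels card_outside_part.
  apply: leq_trans (part_size_le_max part (part z)) _; apply: leq_trans bound _.
  rewrite leq_pexp2l // leq_mul2l ltnS sum_part_size leq_sub2l ?orbT //.
  exact: part_size_le_max.
exists (order_params z p code); exact: order_params_linear code_labels.
Qed.

Theorem theorem4p28 (C : graph -> Prop)
    (HC : forall G, C G -> is_complete_multipartite G) :
  (MSO2_orderable C <->
     exists s : nat, SEP C (fun k => 2 ^ (s * k.+1))) /\
  ((exists s : nat, SEP C (fun k => 2 ^ (s * k.+1))) <->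
     exists s : nat, forall G, C G ->
       forall (d : nat) (part : gV G -> 'I_d), cmp_witness part ->
         let M := \max_(i < d) part_size part i in
         let N := \sum_(i < d) part_size part i in
         M <= 2 ^ (s * (N - M).+1)).
Proof.
split; last by split=> -[s] /(SEP_iff_max_part_bound HC) bound; exists s.
split=> [[k [phi [wf ord]]]|[s /(SEP_iff_max_part_bound HC) bound]].
  exists k; apply/(SEP_iff_max_part_bound HC) => G CG d part wit.
  exact: max_part_bound_of_order wit _ _ wf (ord G CG).
exists s.*2.+4, (order_fm s); split=> [|G CG]; first exact: order_fm_wf.
have [d [part wit]] := HC G CG.
exact: order_fm_defines_order wit (bound G CG d part wit).
Qed.
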